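(* Let $p>1$ and $C_\beta>0$. There exists a constant $C>0$, depending only on $p$ and $C_\beta$, such that for every Banach space $X$ which satisfies property $(\beta_p)$ with constant $C_\beta$ and every $n\in\mathbb{N}$, the minimum distortion necessary for embedding the complete countably branching tree $T_n^\omega$ of height $n$ into $X$ is at least $C(\log n)^{1/p}$; that is, every bi-Lipschitz embedding $f:T_n^\omega\to X$ satisfies $\mathrm{dist}(f)\ge C(\log n)^{1/p}$.
   Context: Property $(\beta_p)$: a Banach space $(X,\|\cdot\|)$ with closed unit ball $B_X$ has Rolewicz's property $(\beta)$ if for all $t>0$ there exists $\beta(t)>0$ such that for all $z\in B_X$ and all $\{x_n\}_{n\in\mathbb{N}}\subset B_X$ with $\inf_{i\ne j}\|x_i-x_j\|\ge t$, there exists $i_0\in\mathbb{N}$ such that $\left\|\frac{z-x_{i_0}}{2}\right\|\le 1-\beta(t)$. It has property $(\beta_p)$, for $p>1$, with constant $C_\beta>0$ if one can take $\beta(t)\ge t^p/C_\beta$ for all $t>0$. Tree: $T_n^\omega$ is the complete countably branching tree of height $n$ (every vertex at level less than $n$ has countably infinitely many children) with the shortest path metric. It is encoded as $[\mathbb{N}]^{\le n}=\{A\subset\mathbb{N}:0\le|A|\le n\}$, with elements written as increasing tuples and the root being the empty set, and with metric $d_T$: if $\bar u$ is the longest common initial segment of $\bar m=(\bar u,m_1,\dots,m_k)$ and $\bar n=(\bar u,n_1,\dots,n_l)$, then $d_T(\bar m,\bar n)=k+l$. Distortion: for metric spaces $(Y,d_Y)$, $(X,d_X)$ and a map $f:Y\to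 X$, $\mathrm{dist}(f)$ is the smallest $K\ge 1$ for which there is $\lambda>0$ with $\lambda d_Y(x,y)\le d_X(f(x),f(y))\le K\lambda d_Y(x,y)$ for all $x,y\in Y$; $f$ is bi-Lipschitz if such a $K$ exists. *)

(* Defs.v *)
From mathcomp Require Import all_boot all_order all_algebra.
From mathcomp Require Import all_classical all_reals all_analysis.
Import Order.TTheory GRing.Theory Num.Theory.
Import numFieldNormedType.Exports.
Set Implicit Arguments.
Unset Strict Implicit.
Unset Printing Implicit Defensive.

Local Open Scope classical_set_scope.
Local Open Scope ring_scope.

Section PropertyBeta.
Context {R : realType}.

Definition separation (X : normedModType R) (x : nat -> X) : R :=
  inf [set r | exists i j : nat, i != j /\ r = `|x i - x j|].

Definition beta_modulus (X : normedModType R) (beta : R -> R) : Prop :=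
  forall t : R, 0 < t ->
    0 < beta t /\
    forall (z : X) (x : nat -> X),
      `|z| <= 1 -> (forall i, `|x i| <= 1) -> t <= separation x ->
      exists i0 : nat, `|2^-1 *: (z - x i0)| <= 1 - beta t.

Definition property_beta (X : normedModType R) : Prop :=
  exists beta : R -> R, beta_modulus X beta.

Definition property_beta_p (p Cb : R) (X : normedModType R) : Prop :=
  exists beta : R -> R,
    beta_modulus X beta /\ forall t : R, 0 < t -> t `^ p / Cb <= beta t.

End PropertyBeta.

(* Vertices of the tree of height n: subsets of nat with at most n elements,
   written as strictly increasing sequences; the root is [::] and the children
   of s are the rcons s m with m larger than every entry of s. *)
Definition tree (n : nat) : Type :=
  {s : seq nat | sorted ltn s && (size s <= n)%N}.

Fixpoint common_prefix (s t : seq nat) : seq nat :=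
  match s, t with
  | x :: s', y :: t' => if x == y then x :: common_prefix s' t' else [::]
  | _, _ => [::]
  end.

Lemma prefix_common_prefix (u s t : seq nat) :
  prefix u (common_prefix s t) = prefix u s && prefix u t.
Proof.
elim: u s t => [|a u IH] [|x s] [|y t]; rewrite ?prefix0s //= ?andbF //.
have [<-|xy] := eqVneq x y; first by rewrite /= IH; case: (a == x).
have [->|//] := eqVneq a x.
by rewrite (negbTE xy) andbF.
Qed.

Definition tree_dist (R : realType) (n : nat) (a b : tree n) : R :=
  let u := common_prefix (val a) (val b) in
  ((size (val a) - size u) + (size (val b) - size u))%N%:R.

Definition norm_dist (R : realType) (X : normedModType R) (x y : X) : R :=
  `|x - y|.

Section Distortion.
Context {R : realType} {Y X : Type}.
Variables (dY : Y -> Y -> R) (dX : X -> X -> R) (f : Y -> X).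

Definition has_distortion (K : R) : Prop :=
  1 <= K /\ exists lambda : R, 0 < lambda /\
    forall x y : Y, lambda * dY x y <= dX (f x) (f y) <= K * lambda * dY x y.

Definition bilipschitz : Prop := exists K : R, has_distortion K.

Definition distortion : R := inf [set K | has_distortion K].

(* The infimum defining the distortion is a minimum. *)
Lemma has_distortion_distortion :
  (forall x y, 0 <= dY x y) -> bilipschitz -> has_distortion distortion.
Proof.
move=> dY0 [K0 K0P].
have hi : has_inf [set K | has_distortion K].
  by split; [exists K0 | exists 1 => K []].
have D1 : 1 <= distortion by apply: lb_le_inf => [|K []//]; exists K0.
case: K0P => [K01 [l0 [l0p l0P]]].
pose S := [set r | exists x y, 0 < dY x y /\ r = dX (f x) (f y) / dY x y].
have [Sne|S0] := pselect (S !=set0); last first.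
  split=> //; exists l0; split=> // x y.
  have d0 : dY x y = 0.
    apply/eqP/negPn/negP => dn0; apply: S0.
    exists (dX (f x) (f y) / dY x y), x, y; split=> //.
    by rewrite lt_neqAle eq_sym dn0 dY0.
  by have := l0P x y; rewrite d0 !mulr0.
have lbS l K : (forall x y, l * dY x y <= dX (f x) (f y) <= K * l * dY x y) ->
    lbound S l.
  move=> h _ [x [y [d0 ->]]]; rewrite ler_pdivlMr //.
  by case/andP: (h x y).
have hiS : has_inf S by split=> //; exists l0; exact: (lbS _ K0).
pose m := inf S.
have l0m : l0 <= m by apply: lb_le_inf => //; exact: (lbS _ K0).
have m0 : 0 < m by exact: lt_le_trans l0m.
split=> //; exists m; split=> // x y.
have := dY0 x y; rewrite le_eqVlt => /predU1P[/esym d0|dpos].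
  by have := l0P x y; rewrite d0 !mulr0.
apply/andP; split.
  rewrite -ler_pdivlMr //; apply: ge_inf; first by case: hiS.
  by exists x, y.
rewrite -ler_pdivrMr // -ler_pdivrMr //.
apply: lb_le_inf => [|K [K1 [l [lp lP]]]]; first by case: hi.
rewrite ler_pdivrMr // ler_pdivrMr //.
case/andP: (lP x y) => _ /le_trans; apply.
rewrite ler_wpM2r // ler_wpM2l ?(le_trans ler01) //.
by apply: lb_le_inf => //; exact: (lbS _ K).
Qed.

End Distortion.

(* Main.v *)
Require Import Defs.
From mathcomp Require Import all_boot all_order all_algebra.
From mathcomp Require Import all_classical all_reals all_analysis.
From mathcomp Require Import lra zify.
Import Order.TTheory GRing.Theory Num.Theory.
Import numFieldNormedType.Exports.
Local Open Scope ring_scope.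

(** The idea is that property (beta_p) forces any embedding of a tree to
    contract a little at the next scale, so that passing to a sparser subtree
    strictly improves the distortion; but a distortion is never below 1, so
    only few such improvements are possible.

    Suppose a map on the tree of height 2N is bounded below by
    [lambda * distance], and moves adjacent vertices by at most [D * lambda].
    Given a vertex x and a child y of x, the images of x and of the
    grandchildren z_i of x below y lie in the ball of radius [D * lambda]
    around the image of y, and the images of the z_i are [2 * lambda]-separated.
    Rescaled to the unit ball, this is a [2 / D]-separated sequence, so
    (beta_p) produces some z_i with
      |f x - f z_i| <= 2 * lambda * D * (1 - (2 / D)^p / Cb)
    ([exists_close_tip]).  Keeping one such grandchild below each child of each
    retained vertex selects a countably branching subtree of height N in which
    all distances are exactly doubled ([seq_dist_spread]).  The map restricted
    to it has lower constant [2 * lambda], and edge constant D' with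
      D'^p <= D^p (1 - (2 / D)^p / Cb) = D^p - 2^p / Cb
    ([powR_contraction]).  Measuring the decrease on D^p makes it
    independent of D; this is what avoids losing a factor log D.
    Starting at height 2^k, k halvings are possible, hence
      1 + k * 2^p / Cb <= D^p
    ([tree_embedding_lower_bound]), and k is about log n. *)

(** * The unordered tree of finite sequences *)

(** The distance of [tree_dist] on arbitrary, not necessarily increasing,
    sequences: passing to subtrees then needs no reindexing of children. *)
Definition seq_dist (s t : seq nat) : nat :=
  let u := common_prefix s t in ((size s - size u) + (size t - size u))%N.

Lemma seq_dist_cons x s t : seq_dist (x :: s) (x :: t) = seq_dist s t.
Proof. by rewrite /seq_dist /= eqxx /= !subSS. Qed.

Lemma seq_dist_cons_neq x y s t : x != y ->
  seq_dist (x :: s) (y :: t) = (size s + size t).+2.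
Proof. by rewrite /seq_dist /= => /negbTE->; rewrite !subn0 addSn addnS. Qed.

Lemma seq_dist_nil s : seq_dist [::] s = size s.
Proof. by rewrite /seq_dist /= !subn0 add0n. Qed.

Lemma seq_dist_nilr s : seq_dist s [::] = size s.
Proof. by rewrite /seq_dist; case: s => //= x s; rewrite !subn0 addn0. Qed.

Lemma seq_dist_cat u s t : seq_dist (u ++ s) (u ++ t) = seq_dist s t.
Proof. by elim: u => //= x u <-; rewrite seq_dist_cons. Qed.

Lemma seq_dist_rcons s a : seq_dist s (rcons s a) = 1.
Proof. by rewrite -cats1 -{1}(cats0 s) seq_dist_cat seq_dist_nil. Qed.

(** The entries of [s] count the integers skipped before each new entry of the
    increasing sequence; with [m = 0] this identifies the tree of all sequences
    with the tree of increasing ones. *)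
Fixpoint increasing_code (m : nat) (s : seq nat) : seq nat :=
  if s is a :: s' then (m + a)%N :: increasing_code (m + a).+1 s' else [::].

Lemma size_increasing_code m s : size (increasing_code m s) = size s.
Proof. by elim: s m => //= a s IH m; rewrite IH. Qed.

Lemma path_increasing_code m s : path ltn m (increasing_code m.+1 s).
Proof. by elim: s m => //= a s IH m; rewrite IH andbT; lia. Qed.

Lemma sorted_increasing_code m s : sorted ltn (increasing_code m s).
Proof. by case: s => //= a s; exact: path_increasing_code. Qed.

Lemma seq_dist_increasing_code m s t :
  seq_dist (increasing_code m s) (increasing_code m t) = seq_dist s t.
Proof.
elim: s m t => [|a s IH] m t.
  by rewrite /= !seq_dist_nil size_increasing_code.
case: t => [|b t].
  by rewrite [increasing_code _ [::]]/= !seq_dist_nilr size_increasing_code.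
have [<-|ab] := eqVneq a b; first by rewrite /= !seq_dist_cons IH.
by rewrite /= !seq_dist_cons_neq ?eqn_add2l// !size_increasing_code.
Qed.

(** * A subtree on which distances double *)

(** [spread b u s] is the path that leads from the vertex [u] to the vertex of
    the subtree indexed by [s]: the child of [v] numbered [a] in the subtree is
    the grandchild [v ++ [:: a; b v a]] of [v]. *)
Fixpoint spread (b : seq nat -> nat -> nat) (u s : seq nat) : seq nat :=
  if s is a :: s' then a :: b u a :: spread b (u ++ [:: a; b u a]) s'
  else [::].

Section Spread.
Variable b : seq nat -> nat -> nat.

Lemma size_spread u s : size (spread b u s) = (size s).*2.
Proof. by elim: s u => //= a s IH u; rewrite IH. Qed.

Lemma spread_rcons u s a : spread b u (rcons s a) =
  spread b u s ++ [:: a; b (u ++ spread b u s) a].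
Proof.
elim: s u => [|c s IH] u /=; first by rewrite cats0.
by rewrite IH -catA.
Qed.

(** Distinct children of a retained vertex lie below distinct children of it
    in the big tree, so that nothing is lost in the distance. *)
Lemma seq_dist_spread u s t :
  seq_dist (spread b u s) (spread b u t) = (seq_dist s t).*2.
Proof.
elim: s u t => [|a s IH] u t; first by rewrite /= !seq_dist_nil size_spread.
case: t => [|c t].
  by rewrite [spread _ _ [::]]/= !seq_dist_nilr size_spread.
have [<-|ac] := eqVneq a c; first by rewrite /= !seq_dist_cons IH.
by rewrite /= !seq_dist_cons_neq//= !size_spread; lia.
Qed.

End Spread.

(** * One step of contraction *)

Section Contraction.
Variables (R : realType) (p Cb : R).
Hypotheses (p1 : 1 < p) (Cb0 : 0 < Cb).

(** Property (beta_p) for the fork with handle [x], centre [y] and tips [z i]: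
    the tips cannot all be almost antipodal to [x]. *)
Lemma exists_close_tip (X : normedModType R) (x y : X) (z : nat -> X) (r t : R) :
  property_beta_p p Cb X -> 0 < r -> 0 < t ->
  `|x - y| <= r -> (forall i, `|y - z i| <= r) ->
  (forall i j, i != j -> t * r <= `|z i - z j|) ->
  exists i, `|x - z i| <= 2 * r * (1 - t `^ p / Cb).
Proof.
move=> [beta [betaP tbeta]] r0 t0 xy yz zz.
have [_ /(_ (r^-1 *: (x - y)) (fun i => r^-1 *: (z i - y)))] := betaP t t0.
have normZ (w : X) : `|r^-1 *: w| = `|w| / r.
  by rewrite normrZ gtr0_norm ?invr_gt0// mulrC.
case=> [|i||i].
- by rewrite normZ ler_pdivrMr// mul1r.
- by rewrite normZ ler_pdivrMr// mul1r distrC.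
- apply: lb_le_inf => [|_ [i [j [ij ->]]]].
    by exists `|r^-1 *: (z 0 - y) - r^-1 *: (z 1 - y)|, 0, 1.
  by rewrite -scalerBr opprB addrA subrK normZ ler_pdivlMr// zz.
rewrite -scalerBr opprB addrA subrK normrZ normZ gtr0_norm ?invr_gt0// => h.
exists i; have := tbeta t t0.
have : `|x - z i| / r <= 2 * (1 - beta t) by lra.
by rewrite ler_pdivrMr//; nra.
Qed.

Lemma powR_contraction (D : R) : 0 < D -> 0 <= 1 - (2 / D) `^ p / Cb ->
  (D * (1 - (2 / D) `^ p / Cb)) `^ p <= D `^ p - 2 `^ p / Cb.
Proof.
move=> D0 e0; set e := 1 - _ in e0 *.
have -> : D `^ p - 2 `^ p / Cb = D `^ p * e.
  by rewrite /e mulrBr mulr1 mulrA -powRM ?divr_ge0 ?ltW// mulrCA divff ?gt_eqF// mulr1.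
rewrite powRM ?(ltW D0)// ler_wpM2l ?powR_ge0//.
move: e0; rewrite le_eqVlt => /predU1P[<-|e0].
  by rewrite powR0// gt_eqF// (lt_trans ltr01).
rewrite ge1r_powR ?(ltW p1)// e0/= lerBlDr lerDl.
by rewrite divr_ge0 ?powR_ge0 ?ltW.
Qed.

(** The upper bound is imposed on edges only: by the triangle inequality it
    amounts to a Lipschitz bound, and the choice of grandchildren improves
    exactly the distance from a vertex to its children in the subtree. *)
Definition tree_embedding (X : normedModType R) (N : nat) (lambda D : R)
    (f : seq nat -> X) : Prop :=
  (forall s t, (size s <= N)%N -> (size t <= N)%N ->
     lambda * (seq_dist s t)%:R <= `|f s - f t|) /\
  (forall s a, (size s < N)%N -> `|f s - f (rcons s a)| <= D * lambda).

Lemma tree_embedding_ge1 (X : normedModType R) N lambda D (f : seq nat -> X) :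
  (0 < N)%N -> 0 < lambda -> tree_embedding X N lambda D f -> 1 <= D.
Proof.
move=> N0 l0 [low up].
have := le_trans (low [::] [:: 0%N] isT N0) (up [::] 0%N N0).
by rewrite seq_dist_nil mulr1 ler_pMl.
Qed.

Lemma tree_embedding_contract (X : normedModType R) N lambda D
    (f : seq nat -> X) :
  property_beta_p p Cb X -> (0 < N)%N -> 0 < lambda ->
  tree_embedding X N.*2 lambda D f ->
  exists g, tree_embedding X N (2 * lambda) (D * (1 - (2 / D) `^ p / Cb)) g.
Proof.
move=> betaX N0 l0 ef; have [low up] := ef.
have D0 : 0 < D.
  by rewrite (lt_le_trans ltr01)// (tree_embedding_ge1 _ _ _ _ _ _ l0 ef) ?double_gt0.
(* For every child [rcons u a] of [u], some grandchild below it is close. *)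
have close_grandchild (u : seq nat * nat) : exists i, (size u.1 < N.*2.-1)%N ->
    `|f u.1 - f (u.1 ++ [:: u.2; i])| <=
    2 * (D * lambda) * (1 - (2 / D) `^ p / Cb).
  case: u => u a /=; have [uN|] := boolP (size u < N.*2.-1)%N; last by exists 0%N.
  have [||||i j ij|i ?] := exists_close_tip X (f u) (f (rcons u a))
    (fun i => f (u ++ [:: a; i])) (D * lambda) (2 / D) betaX.
  - exact: mulr_gt0.
  - exact: divr_gt0.
  - by apply: up; lia.
  - by move=> i; rewrite -cat_rcons cats1; apply: up; rewrite size_rcons; lia.
  - have -> : 2 / D * (D * lambda) = lambda * 2%:R.
      by rewrite mulrA divfK ?gt_eqF// mulrC.
    have <- : seq_dist (u ++ [:: a; i]) (u ++ [:: a; j]) = 2%N.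
      by rewrite seq_dist_cat seq_dist_cons seq_dist_cons_neq.
    by apply: low; rewrite size_cat/=; lia.
  - by exists i.
have [b bP] := choice close_grandchild.
pose g s := f (spread (fun u a => b (u, a)) [::] s).
exists g; split => [s t sN tN|s a sN].
  have := low (spread (fun u a => b (u, a)) [::] s)
              (spread (fun u a => b (u, a)) [::] t).
  rewrite !size_spread !leq_double => /(_ sN tN); apply: le_trans.
  by rewrite seq_dist_spread -muln2 natrM; lra.
rewrite /g spread_rcons cat0s.
have := bP (spread (fun u a => b (u, a)) [::] s, a); rewrite /= size_spread.
by move=> /(_ ltac:(lia)) /le_trans; apply; lra.
Qed.

(** The constants of the successive subtrees decrease on the scale of [D `^ p]
    by [2 `^ p / Cb] at least, and the last one is still at least [1]. *)
Lemma tree_embedding_lower_bound (X : normedModType R) k lambda D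
    (f : seq nat -> X) :
  property_beta_p p Cb X -> 0 < lambda ->
  tree_embedding X (2 ^ k) lambda D f -> 1 + k%:R * (2 `^ p / Cb) <= D `^ p.
Proof.
move=> betaX; elim: k lambda D f => [|k IH] lambda D f l0 ef.
  have D1 := tree_embedding_ge1 _ (2 ^ 0) _ _ _ isT l0 ef.
  rewrite mul0r addr0; have <- : 1 `^ p = 1 :> R by rewrite powR1.
  by rewrite ge0_ler_powR ?nnegrE ?ler01// ?(le_trans ler01 D1)// ltW ?(lt_trans ltr01).
have k0 j : (0 < 2 ^ j)%N by rewrite expn_gt0.
have D1 := tree_embedding_ge1 _ _ _ _ _ (k0 k.+1) l0 ef.
move: ef; rewrite expnS mul2n => /tree_embedding_contract.
move=> /(_ betaX (k0 k) l0)[g eg].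
have l2 : 0 < 2 * lambda by rewrite mulr_gt0.
have D'1 := tree_embedding_ge1 _ _ _ _ _ (k0 k) l2 eg.
have e0 : 0 <= 1 - (2 / D) `^ p / Cb.
  by rewrite -(pmulr_rge0 _ (lt_le_trans ltr01 D1)); lra.
have := IH _ _ _ l2 eg.
have := powR_contraction D (lt_le_trans ltr01 D1) e0.
by rewrite -(natr1 k); lra.
Qed.

End Contraction.

(** * The logarithmic bound *)

Lemma ln_nat_le_trunc_log (R : realType) (n : nat) : (0 < n)%N ->
  ln n%:R <= 1 + (trunc_log 2 n)%:R :> R.
Proof.
move=> n0; have := trunc_log_ltn n (isT : (1 < 2)%N).
set k := trunc_log 2 n => nk.
have -> : 1 + k%:R = k.+1%:R :> R by rewrite -natr1 addrC.
apply: (@le_trans _ _ (ln (2 ^+ k.+1))).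
  by rewrite ler_ln ?posrE ?ltr0n ?exprn_gt0// -natrX ler_nat ltnW.
rewrite lnXn// -[X in _ <= X]mulr1 mulr_natl lerMn2r/=.
by have := @le_ln1Dx R 1; apply; lra.
Qed.

(** The map is pulled back along [increasing_code]; sequences too long to code
    a vertex are sent to the root, and no estimate concerns them. *)
Lemma tree_embedding_of_distortion (R : realType) (X : normedModType R)
    (n N : nat) (K : R) (f : tree n -> X) : (N <= n)%N ->
  has_distortion (@tree_dist R n) (@norm_dist R X) f K ->
  exists2 lambda : R, 0 < lambda & exists g, tree_embedding R X N lambda K g.
Proof.
move=> Nn [_ [lambda [l0 fP]]]; exists lambda => //.
pose nil_vertex : tree n := exist _ [::] isT.
pose g s : tree n := insubd nil_vertex (increasing_code 0 s).
have val_g s : (size s <= N)%N -> val (g s) = increasing_code 0 s.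
  move=> sN; rewrite insubdK//.
  by rewrite unfold_in sorted_increasing_code size_increasing_code (leq_trans sN).
have gd s t : (size s <= N)%N -> (size t <= N)%N ->
    @tree_dist R n (g s) (g t) = (seq_dist s t)%:R.
  move=> sN tN; rewrite -(seq_dist_increasing_code 0).
  by rewrite /tree_dist !val_g.
exists (f \o g); split => [s t sN tN|s a sN].
  by rewrite -gd//; case/andP: (fP (g s) (g t)).
have /andP[_] := fP (g s) (g (rcons s a)).
by rewrite gd ?size_rcons// 1?ltnW// seq_dist_rcons mulr1.
Qed.

Theorem theorem2p7 (R : realType) (p Cb : R) (hp : 1 < p) (hCb : 0 < Cb) :
  exists C : R, 0 < C /\
    forall X : completeNormedModType R, property_beta_p p Cb X ->
    forall n : nat, (0 < n)%N ->
    forall f : tree n -> X,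
      bilipschitz (@tree_dist R n) (@norm_dist R X) f ->
      C * (ln n%:R) `^ (p^-1) <= distortion (@tree_dist R n) (@norm_dist R X) f.
Proof.
(* From [1 + k * (2 `^ p / Cb) <= K `^ p] to a multiple of [1 + k], which
   dominates [ln n]. *)
pose c : R := Num.min 1 (2 `^ p / Cb).
have c0 : 0 < c by rewrite lt_min ltr01 divr_gt0// powR_gt0.
exists (c `^ p^-1); split=> [|X betaX n n0 f fL]; first exact: powR_gt0.
have fK : has_distortion (@tree_dist R n) (@norm_dist R X) f
    (distortion (@tree_dist R n) (@norm_dist R X) f).
  by apply: has_distortion_distortion => // x y; exact: ler0n.
move: (distortion _ _ f) fK => K fK; have [K1 _] := fK.
have p0 : 0 < p by lra.
set k := trunc_log 2 n.
have kn : (2 ^ k <= n)%N by exact: trunc_logP.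
have [lambda l0 [g eg]] := tree_embedding_of_distortion R X n _ K f kn fK.
have Kp := tree_embedding_lower_bound R p Cb hp hCb X k lambda K g betaX l0 eg.
have ln0' : 0 <= ln n%:R :> R by apply: ln_ge0; rewrite ler1n.
have clnK : c * ln n%:R <= K `^ p.
  apply: le_trans Kp; apply: (@le_trans _ _ (c * (1 + k%:R))).
    by rewrite ler_wpM2l ?(ltW c0)// ln_nat_le_trunc_log.
  by rewrite mulrDr mulr1 lerD ?ge_min ?lexx// mulrC ler_wpM2l// ge_min lexx orbT.
rewrite -powRM ?(ltW c0)//.
have -> : K = (K `^ p) `^ p^-1 by rewrite -powRrM divff ?gt_eqF// powRr1//; lra.
by rewrite ge0_ler_powR ?nnegrE ?invr_ge0 ?powR_ge0 ?mulr_ge0 ?(ltW c0) ?(ltW p0).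
Qed.
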